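(* As $n\to\infty$, $\log\mathbb{P}(\pi_n\text{ is }m\text{-smooth})\sim\log\rho(u)$ uniformly in $1\le m\le n$, where $u=n/m$. That is, for every $\eta>0$ there is $N$ such that for all integers $n\ge N$ and $1\le m\le n$, $$\left|\log\mathbb{P}(\pi_n\text{ is }m\text{-smooth})-\log\rho(n/m)\right|\le\eta\,\left|\log\rho(n/m)\right|.$$
   Context: $\log$ is the natural logarithm. $\pi_n$ is a uniformly random permutation in the symmetric group $S_n$; a permutation is $m$-smooth if all its cycles have length at most $m$. $\rho:[0,\infty)\to(0,1]$ is the Dickman function: the continuous function with $\rho(t)=1$ for $t\in[0,1]$ and $t\rho'(t)+\rho(t-1)=0$ for $t>1$. (When $m=n$ both logarithms equal $0$.) *)

(* Defs.v *)
From mathcomp Require Import all_boot all_order all_fingroup all_algebra.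
From mathcomp Require Import all_classical all_reals all_analysis.

Set Implicit Arguments.
Unset Strict Implicit.
Unset Printing Implicit Defensive.

Import Order.TTheory GRing.Theory Num.Theory.
Import numFieldNormedType.Exports.

Local Open Scope classical_set_scope.
Local Open Scope ring_scope.

(* [porbits s] contains the singleton orbits, so fixed points count as cycles
   of length 1. *)
Definition smooth_perm (n m : nat) (s : 'S_n) : bool :=
  [forall C in porbits s, (#|C| <= m)%N].

Definition fin_uniform_prob (R : realType) (T : finType) (P : pred T) : R :=
  #|P|%:R / #|T|%:R.

(* These conditions determine [rho] on [0, +oo[ and say nothing about its
   values at negative reals. Differentiability is only required at t > 1:
   [rho] has a corner at t = 1. *)
Definition is_dickman (R : realType) (rho : R -> R) : Prop :=
  [/\ forall t : R, 0 <= t -> 0 < rho t <= 1,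
      {within `[0, +oo[, continuous rho},
      forall t : R, 0 <= t <= 1 -> rho t = 1 &
      forall t : R, 1 < t ->
        derivable rho t 1 /\ t * derive1 rho t + rho (t - 1) = 0].

(* Main.v *)
Require Import Defs.
From mathcomp Require Import all_boot all_order all_fingroup all_algebra.
From mathcomp Require Import all_classical all_reals all_analysis.
From mathcomp Require Import ring lra.

(** Fix [m] and let [p n] be the probability that a uniform permutation of [n]
    points is [m]-smooth.  Sorting permutations by the length of the cycle
    through a given point, which is uniform on [1..n], gives the recurrence
    [n p(n) = sum_(1 <= k <= m) p(n - k)] for [n >= m], with [p n = 1] for
    [n <= m] ([card_smooth_on_prob], [smooth_prob_rec]).

    The Dickman function satisfies the continuous analogue
    [t rho(t) = int_(t-1)^t rho] ([dickman_integral]).  As [rho] is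
    nonincreasing, cutting this integral into [m], resp. [m + 1], equal pieces
    compares it with left and right Riemann sums, which are the recurrence of
    [p] up to an inequality.  Induction on [n] then gives the sandwich
    [rho(n / m) <= p n <= rho((n + 1) / (m + 1))]
    ([smooth_prob_ge_dickman], [smooth_prob_le_dickman]).  Hence, writing
    [L = - ln rho] and [u = n / m], the claim is
    [(1 - eta) L(u) <= - ln (p n)] for large [n].

    For [u] in a bounded range [[1, U]], [m] is large with [n]; both
    [L(u) - L((n + 1) / (m + 1))] and [L(u)] are controlled by the mean value
    theorem, the former being [O((u - 1) / m)] and the latter at least a
    constant times [u - 1] ([neg_ln_bounded_range]).

    For large [u], whatever [m] is, let [q] be the integer part of [u].
    The recurrence gives [p n <= 1 / q!] ([smooth_prob_le_fact]), so
    [- ln (p n) >= q ln q - q], while the integral equation gives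
    [rho(u) >= (d / u)^k] with [k] about [u / (1 - d)]
    ([dickman_ge_exp]), so [L(q + 1)] is at most about
    [q ln q / (1 - d)]; small [d] concludes ([ln_fact_ge_neg_ln_dickman]). *)

Set Implicit Arguments.
Unset Strict Implicit.
Unset Printing Implicit Defensive.
Import Order.TTheory GRing.Theory Num.Theory.
Import numFieldNormedType.Exports.
Local Open Scope ring_scope.

(** * Counting smooth permutations *)

Section CycleCounting.
(* Names such as [subsetP] and [setIP] refer to finite sets in this section. *)
Import fintype mathcomp.boot.finset.

Lemma porbit_sub_closed (T : finType) (s : {perm T}) (D : {set T}) (z : T) :
  (forall w, w \in D -> s w \in D) -> z \in D -> porbit s z \subset D.
Proof.
move=> Ds Dz; apply/subsetP => _ /porbitP[i ->].
by elim: i => [|i IHi]; rewrite ?expg0 ?perm1// expgSr permM Ds.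
Qed.

Lemma mem_porbit_step (T : finType) (s : {perm T}) (z w : T) :
  w \in porbit s z -> s w \in porbit s z.
Proof. by move=> /porbitP[i ->]; rewrite -permM -expgSr mem_porbit. Qed.

Lemma porbit_fixed (T : finType) (s : {perm T}) (y : T) :
  s y = y -> porbit s y = [set y].
Proof.
move=> sy; apply/eqP; rewrite eqEsubset sub1set porbit_id andbT.
by apply: porbit_sub_closed; rewrite ?set11// => w /set1P ->; rewrite sy set11.
Qed.

(** Precomposing with [tperm x y] inserts a fixed point [y] of [s] into the
    cycle of [x], right after [x], and leaves the other cycles alone.  Every
    permutation with [t x = y] arises so from exactly one [s], which is what
    makes the counting by cycle length recursive. *)
Section Insertion.
Variables (T : finType) (s : {perm T}) (x y : T).
Hypotheses (sy : s y = y) (xy : x != y).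
Local Notation t := (tperm x y * s)%g.

Let tx : t x = y. Proof. by rewrite permM tpermL. Qed.
Let ty : t y = s x. Proof. by rewrite permM tpermR. Qed.
Let tw w : w != x -> w != y -> t w = s w.
Proof. by move=> wx wy; rewrite permM tpermD// eq_sym. Qed.

Lemma porbit_insert : porbit t x = y |: porbit s x.
Proof.
apply/eqP; rewrite eqEsubset; apply/andP; split.
  apply: porbit_sub_closed; last by rewrite !inE porbit_id orbT.
  move=> w; have [->|wy] := eqVneq w y.
    by rewrite ty !inE (mem_porbit_step (porbit_id s x)) orbT.
  rewrite !inE (negPf wy)/= => wx; have [->|wx'] := eqVneq w x.
    by rewrite tx eqxx.
  by rewrite (tw wx' wy) (mem_porbit_step wx) orbT.
have yt : y \in porbit t x by have := mem_porbit_step (porbit_id t x); rewrite tx.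
rewrite subUset sub1set yt/=.
apply: porbit_sub_closed (porbit_id _ _) => w wt.
have [->|wy] := eqVneq w y; first by rewrite sy.
have [->|wx] := eqVneq w x; first by rewrite -ty mem_porbit_step.
by rewrite -tw// mem_porbit_step.
Qed.

Lemma porbit_insert_out z : z \notin y |: porbit s x -> porbit t z = porbit s z.
Proof.
rewrite !inE negb_or => /andP[zy zx].
have ts w : w \in porbit s z -> t w = s w.
  move=> wz; apply: tw; apply: contraNneq zx => wE.
    by rewrite porbit_sym -wE.
  move: wz; rewrite wE porbit_sym porbit_fixed// inE => /eqP zE.
  by rewrite zE eqxx in zy.
apply/eqP; rewrite eqEsubset; apply/andP; split.
  apply: porbit_sub_closed (porbit_id _ _) => w wz.
  by rewrite ts// mem_porbit_step.
apply: (subset_trans (B := pred_of_set (porbit t z :&: porbit s z))).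
  apply: porbit_sub_closed; last by rewrite inE !porbit_id.
  by move=> w /setIP[wt ws]; rewrite inE -{1}ts// !mem_porbit_step.
exact: subsetIl.
Qed.

Lemma card_porbit_insert : #|porbit t x| = #|porbit s x|.+1.
Proof.
rewrite porbit_insert cardsU1 porbit_sym porbit_fixed// inE xy.
by rewrite add1n.
Qed.

End Insertion.

Section Counting.
Variables (T : finType) (m : nat).
Hypothesis m_gt0 : (0 < m)%N.
Implicit Types (A : {set T}) (x y : T) (s t : {perm T}).

Definition smooth_on A : {set {perm T}} :=
  [set s | perm_on A s & [forall z, (#|porbit s z| <= m)%N]].

(** Permutations of [A] whose cycle through [x] has length [k], with no bound
    on that length: only the other cycles have to be short.  Dropping the bound
    lets the cycle of [x] be shortened one point at a time. *)
Definition pointed_on k x A : {set {perm T}} :=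
  [set s | [&& perm_on A s, #|porbit s x| == k &
     [forall z, (z \in porbit s x) || (#|porbit s z| <= m)%N]]].

Lemma perm_onD1 A y s : perm_on (A :\ y) s = perm_on A s && (s y == y).
Proof.
apply/idP/andP => [sAy|[sA /eqP sy]].
  split; last by rewrite (out_perm sAy)// !inE eqxx.
  exact: subset_trans sAy (subsetDl _ _).
apply/subsetP => z sz; rewrite !inE (subsetP sA _ sz) andbT.
by apply: contraTneq sz => ->; rewrite inE sy eqxx.
Qed.

Lemma pointed_on1 x A : pointed_on 1 x A = smooth_on (A :\ x).
Proof.
apply/setP => s; rewrite !inE perm_onD1 -andbA; congr (_ && _).
have [sx|sx] := eqVneq (s x) x; last first.
  rewrite (_ : _ == _ = false)//; apply/negbTE/negP => /cards1P[z zE].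
  have /set1P xz : x \in [set z] by rewrite -zE porbit_id.
  have /set1P sxz : s x \in [set z] by rewrite -zE mem_porbit_step// porbit_id.
  by rewrite sxz xz eqxx in sx.
rewrite porbit_fixed// cards1 eqxx/=; apply: eq_forallb => z; rewrite inE.
have [->|//] := eqVneq z x; by rewrite porbit_fixed// cards1 m_gt0.
Qed.

Lemma pointed_on_insert k x y A t : y \in A -> x \in A -> x != y ->
  (t \in pointed_on k.+1 x A) && (t x == y) =
  ((tperm x y * t)%g \in pointed_on k x (A :\ y)).
Proof.
move=> yA xA xy; set s := (tperm x y * t)%g.
have tE : t = (tperm x y * s)%g by rewrite /s mulgA tperm2 mul1g.
have -> : (t x == y) = (s y == y) by rewrite /s permM tpermR.
rewrite !inE perm_onD1.
have -> : perm_on A t = perm_on A s.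
  have ontp : perm_on A (tperm x y).
    by apply: subset_trans (tperm_on x y) _; apply/subsetP => z /set2P[]->.
  by apply/idP/idP => h; [rewrite /s perm_onM|rewrite tE perm_onM].
have [sy|] := eqVneq (s y) y; last by rewrite !andbF.
rewrite !andbT tE; clearbody s.
rewrite card_porbit_insert// eqSS /=; congr [&& _, _ & _].
apply: eq_forallb => z; have [zi|zi] := boolP (z \in y |: porbit s x).
  rewrite porbit_insert// zi/=; move: zi; rewrite !inE => /orP[/eqP->|->//].
  by rewrite (porbit_fixed sy) cards1 m_gt0 orbT.
rewrite (porbit_insert_out sy zi) porbit_insert// (negPf zi).
by move: zi; rewrite !inE negb_or => /andP[_ /negPf ->].
Qed.

(** The point [y = s x] is a free choice in [A :\ x]; removing it from the
    cycle of [x] leaves a permutation of [A :\ y] whose cycle is shorter by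
    one. *)
Lemma card_pointed_onS k x A : (0 < k)%N -> x \in A ->
  #|pointed_on k.+1 x A| = (\sum_(y in A :\ x) #|pointed_on k x (A :\ y)|)%N.
Proof.
move=> k0 xA; rewrite -sum1_card.
rewrite (partition_big (fun s : {perm T} => s x) (mem (A :\ x)))/=; last first.
  move=> s; rewrite !inE => /and3P[sA sk _]; rewrite perm_closed// xA andbT.
  apply: contraTneq sk => sx; rewrite porbit_fixed// cards1 eqSS.
  by rewrite eq_sym -lt0n.
apply: eq_bigr => y; rewrite !inE => /andP[yx yA].
rewrite sum1_card -(card_imset (pointed_on k x (A :\ y)) (mulgI (tperm x y))).
apply: eq_card => t.
rewrite [LHS](_ : _ = (t \in pointed_on k.+1 x A) && (t x == y))//.
rewrite pointed_on_insert// 1?eq_sym//.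
apply/idP/imsetP => [h|[s sP ->]]; last by rewrite mulgA tperm2 mul1g.
by exists (tperm x y * t)%g => //; rewrite mulgA tperm2 mul1g.
Qed.

Lemma card_smooth_on x A :
  #|smooth_on A| = (\sum_(k < m) #|pointed_on k.+1 x A|)%N.
Proof.
rewrite /smooth_on /pointed_on; case: m m_gt0 => // m' _; rewrite -sum1_card.
(* [inord] is exact here, as cycle lengths lie between 1 and m'.+1. *)
rewrite (partition_big (fun s => inord (#|porbit s x|.-1) : 'I_m'.+1) xpredT)//.
apply: eq_bigr => k _; rewrite sum1_card; apply: eq_card => s.
rewrite [LHS]inE !inE -andbA; congr (_ && _).
have orb0 : (0 < #|porbit s x|)%N by rewrite lt0n card_porbit_neq0.
apply/andP/andP => [[/forallP sm /eqP kE]|[/eqP kE /forallP sm]].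
  split; last by apply/forallP => z; rewrite sm orbT.
  by rewrite -kE inordK prednK// sm.
have sm' z : (#|porbit s z| <= m'.+1)%N.
  have /orP[|//] := sm z.
  by rewrite -eq_porbit_mem => /eqP->; rewrite kE.
split; first exact/forallP.
by apply/eqP/val_inj; rewrite /= kE inordK/=.
Qed.

End Counting.

(** The recurrence for the smoothness probabilities reaches back [m] steps, so
    the recursion carries the list of all earlier values, latest first.  Reading
    beyond the end of the list gives 0, which truncates the sum as needed when
    fewer than [m] values exist. *)
Fixpoint smooth_probs (R : numFieldType) (m n : nat) : seq R :=
  if n is n'.+1 then
    (\sum_(k < m) (smooth_probs R m n')`_k) / n%:R :: smooth_probs R m n'
  else [:: 1].

Definition smooth_prob (R : numFieldType) (m n : nat) : R :=
  (smooth_probs R m n)`_0.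

Lemma nth_smooth_probs (R : numFieldType) (m n k : nat) :
  (smooth_probs R m n)`_k = if (k <= n)%N then smooth_prob R m (n - k) else 0.
Proof.
by elim: n k => [|n IHn] [|k] //=; rewrite nth_nil.
Qed.

(** Iterating [card_pointed_onS] shows that, among permutations of [j + 1]
    points, those with a cycle of length [k + 1] through [x] and all others
    short number [j! p(j - k)]; summing over [k < m] is the recurrence that
    defines [smooth_probs]. *)
Lemma card_smooth_on_prob (R : numFieldType) (T : finType) (m : nat)
    (A : {set T}) : (0 < m)%N ->
  #|smooth_on m A|%:R = (#|A|)`!%:R * smooth_prob R m #|A|.
Proof.
move=> m0; move En : #|A| => n; elim/ltn_ind: n A En => n IHn A An.
have step k j (B : {set T}) x : (j < n)%N -> #|B| = j.+1 -> x \in B ->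
    #|pointed_on m k.+1 x B|%:R = j`!%:R * (smooth_probs R m j)`_k.
  elim: k j B => [|k IHk] j B jn Bj xB.
    by rewrite pointed_on1// (IHn j)//; move: Bj; rewrite (cardsD1 x) xB => -[].
  have BD y : y \in B -> #|B :\ y| = j.
    by move=> yB; move: Bj; rewrite (cardsD1 y) yB => -[].
  rewrite card_pointed_onS//; case: j jn Bj BD => [|j] jn Bj BD.
    rewrite big1 ?nth_nil ?mulr0//= ?nth_nil ?mulr0// => y.
    by rewrite (cards0_eq (BD x xB)) inE.
  rewrite natr_sum (eq_bigr (fun=> j`!%:R * (smooth_probs R m j)`_k)).
    by rewrite sumr_const BD// -[LHS]mulr_natl mulrA -natrM -factS.
  move=> y; rewrite !inE => /andP[yx yB]; apply: IHk; rewrite ?BD//.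
    exact: ltnW.
  by rewrite !inE eq_sym yx.
case: n An IHn step => [|n] An IHn step.
  rewrite (_ : smooth_on m A = [set 1%g]) ?cards1 ?mul1r//.
  apply/setP => s; rewrite !inE; apply/andP/eqP => [[sA _]|->].
    by apply: perm_on_id sA _; rewrite An.
  split; first exact: perm_on1.
  by apply/forallP => z; rewrite porbit_fixed ?perm1// cards1.
have [x xA] : exists x, x \in A by apply/set0Pn; rewrite -card_gt0 An.
rewrite (card_smooth_on m0 x) natr_sum.
rewrite (eq_bigr (fun k : 'I_m => n`!%:R * (smooth_probs R m n)`_k)).
  rewrite -mulr_sumr /smooth_prob /= factS natrM (mulrC _ n`!%:R) mulrACA.
  by rewrite mulfV ?pnatr_eq0// mulr1.
by move=> k _; apply: step.
Qed.

Lemma smooth_prob_rec (R : numFieldType) (m n : nat) : (m <= n)%N -> (0 < n)%N ->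
  n%:R * smooth_prob R m n = \sum_(k < m) smooth_prob R m (n - k.+1).
Proof.
case: n => // n mn _; rewrite /smooth_prob/= mulrCA mulfV ?pnatr_eq0// mulr1.
apply: eq_bigr => k _; rewrite nth_smooth_probs ifT//.
by rewrite -ltnS (leq_trans _ mn).
Qed.

Lemma smooth_prob_eq1 (R : numFieldType) (m n : nat) : (n <= m)%N ->
  smooth_prob R m n = 1.
Proof.
elim/ltn_ind: n => -[//|n] IHn nm; rewrite /smooth_prob /=.
rewrite -(subnKC nm) big_split_ord/= [X in _ + X]big1 ?addr0; last first.
  by move=> k _; rewrite nth_smooth_probs leqNgt addSn ltnS leq_addr.
rewrite (eq_bigr (fun=> 1)) ?sumr_const ?card_ord ?mulfV ?pnatr_eq0//.
move=> k _; have kn : (k <= n)%N by rewrite -ltnS ltn_ord.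
rewrite nth_smooth_probs kn subnKC// IHn ?ltnS ?leq_subr//.
by rewrite (leq_trans (leq_subr _ _))// ltnW.
Qed.

Lemma fin_uniform_prob_smooth (R : realType) (m n : nat) : (0 < m)%N ->
  fin_uniform_prob R (@smooth_perm n m) = smooth_prob R m n.
Proof.
move=> m0; rewrite /fin_uniform_prob.
have -> : #|'S_n| = n`!.
  transitivity #|perm_on [set: 'I_n]|; last by rewrite card_perm cardsT card_ord.
  by apply: eq_card => s; rewrite inE; apply/esym/subsetP => z; rewrite inE.
rewrite (_ : #|_| = #|smooth_on m [set: 'I_n]|).
  by rewrite card_smooth_on_prob// cardsT card_ord mulrAC mulfV ?mul1r//.
apply: eq_card => s; rewrite !inE.
have -> : perm_on [set: 'I_n] s by apply/subsetP => z; rewrite inE.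
apply/forall_inP/forallP => [sm z|sm _ /imsetP[z _ ->]//].
exact/sm/imset_f.
Qed.

End CycleCounting.

Local Open Scope classical_set_scope.
(** * Monotonicity and mean value estimates for the Dickman function *)

Section Dickman.
Variables (R : realType) (rho : R -> R).
Hypothesis hrho : is_dickman rho.
Implicit Types t a b u U : R.

Lemma dickman_gt0 t : 0 <= t -> 0 < rho t.
Proof. by case: hrho => h _ _ _ /h /andP[]. Qed.

Lemma dickman_le1 t : 0 <= t -> rho t <= 1.
Proof. by case: hrho => h _ _ _ /h /andP[]. Qed.

Lemma dickman_eq1 t : 0 <= t <= 1 -> rho t = 1.
Proof. by case: hrho => _ _ h _ /h. Qed.

Lemma dickman_continuous t : 0 < t -> {for t, continuous rho}.
Proof.
case: hrho => _ /continuous_within_itvcyP[h _] _ _ t0.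
by apply: h; rewrite in_itv/= t0.
Qed.

Lemma dickman_derive t : 1 < t -> is_derive t 1 rho (- rho (t - 1) / t).
Proof.
case: hrho => _ _ _ h t1; have [dt] := h _ t1.
move=> /eqP; rewrite addr_eq0 => /eqP tE; apply: DeriveDef => //.
rewrite -derive1E -tE mulrC mulKf// gt_eqF//; lra.
Qed.

Lemma dickman_within a b : 0 < a -> {within `[a, b], continuous rho}.
Proof.
move=> a0; apply: continuous_subspace_itv => x; rewrite in_itv/= => /andP[ax _].
by apply: dickman_continuous; lra.
Qed.

Lemma dickman_anti a b : 0 <= a -> a <= b -> rho b <= rho a.
Proof.
move=> a0 ab; have [a1|a1] := leP a 1.
  by rewrite (@dickman_eq1 a) ?a0// dickman_le1//; lra.
have dr x : x \in `]a, b[%R -> is_derive x 1 rho (- rho (x - 1) / x).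
  by rewrite in_itv/= => /andP[ax _]; apply: dickman_derive; lra.
have [|c] := MVT_segment ab dr; first by apply: dickman_within; lra.
rewrite in_itv/= => /andP[ac cb] rE.
rewrite -subr_le0 rE mulNr mulNr oppr_le0 mulr_ge0 ?divr_ge0 ?subr_ge0//; try lra.
by rewrite ltW// dickman_gt0; lra.
Qed.

(** The slope [- rho(c - 1) / c] is at least [- 1], as [rho <= 1 <= c]. *)
Lemma dickman_diff_le a b : 1 <= a -> a <= b -> rho a - rho b <= b - a.
Proof.
move=> a1 ab.
have dr x : x \in `]a, b[%R -> is_derive x 1 rho (- rho (x - 1) / x).
  by rewrite in_itv/= => /andP[ax _]; apply: dickman_derive; lra.
have [|c] := MVT_segment ab dr; first by apply: dickman_within; lra.
rewrite in_itv/= => /andP[ac cb] rE.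
have -> : rho a - rho b = rho (c - 1) / c * (b - a).
  by rewrite -[LHS]opprB rE !mulNr opprK.
rewrite ler_piMl ?subr_ge0// ler_pdivrMr; last lra.
rewrite mul1r; apply: (@le_trans _ _ 1); [apply: dickman_le1|]; lra.
Qed.

(** On [[1, U]] the slope [- rho(c - 1) / c] is at most [- rho U / U]. *)
Lemma dickman_compl_ge u U : 1 <= u -> u <= U ->
  (u - 1) * (rho U / U) <= 1 - rho u.
Proof.
move=> u1 uU.
have dr x : x \in `]1, u[%R -> is_derive x 1 rho (- rho (x - 1) / x).
  by rewrite in_itv/= => /andP[ax _]; apply: dickman_derive; lra.
have [|c] := MVT_segment u1 dr; first by apply: dickman_within; lra.
rewrite in_itv/= => /andP[ac cb] rE.
have -> : 1 - rho u = (u - 1) * (rho (c - 1) / c).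
  rewrite (dickman_eq1 (_ : 0 <= 1 <= 1)) ?ler01 ?lexx// in rE.
  by rewrite -[LHS]opprB rE !mulNr opprK mulrC.
apply: ler_wpM2l; first lra.
apply: ler_pM; [|by rewrite invr_ge0; lra| |].
- by apply/ltW/dickman_gt0; lra.
- by apply: dickman_anti; lra.
- by rewrite lef_pV2 ?posrE; lra.
Qed.

(** Since [rho = 1] on [[0, 1]], on [[0, +oo[] it agrees with
    [x |-> rho (max x 1)], which is continuous on the whole line; the
    fundamental theorem of calculus applies to the latter, even at 0. *)
Lemma dickman_antiderivative :
  exists P : R -> R, forall t, 0 <= t -> is_derive t 1 P (rho t).
Proof.
pose f (x : R) := rho (Num.max x 1).
have fc : continuous f.
  move=> x; apply: continuous_comp; last first.
    by apply: dickman_continuous; rewrite lt_max ltr01 orbT.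
  by apply: continuous_max; [exact: cvg_id|exact: cvg_cst].
exists (fun x => \int[lebesgue_measure]_(t in `[-1, x]) f t)%R => t t0.
have fi : lebesgue_measure.-integrable `[-1, (t + 1)] (EFin \o f).
  apply: continuous_compact_integrable; first exact: segment_compact.
  exact: continuous_subspaceT.
have tt : t < t + 1 by lra.
have [|d1 d2] := continuous_FTC1_closed tt fi _ (fc t); first lra.
apply: DeriveDef => //; rewrite -derive1E d2 /f.
have [//|t1] := leP 1 t.
by rewrite !dickman_eq1 ?lexx ?ler01 ?t0 ?(ltW t1).
Qed.

End Dickman.
(** * The integral equation and its Riemann sums *)

Section DickmanIntegral.
Variables (R : realType) (rho : R -> R).
Hypothesis hrho : is_dickman rho.
Variable P : R -> R.
Hypothesis dP : forall t : R, 0 <= t -> is_derive t 1 P (rho t).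
Implicit Types t a b u U : R.

Lemma antiderivative_within a b : 0 <= a -> {within `[a, b], continuous P}.
Proof.
move=> a0; apply: derivable_within_continuous => x.
rewrite in_itv/= => /andP[ax _]; have x0 : 0 <= x by lra.
by have [] := dP x0.
Qed.

Lemma antiderivative_bounds a b : 0 <= a -> a <= b ->
  (b - a) * rho b <= P b - P a <= (b - a) * rho a.
Proof.
move=> a0 ab.
have dr x : x \in `]a, b[%R -> is_derive x 1 P (rho x).
  by rewrite in_itv/= => /andP[ax _]; apply: dP; lra.
have [|c] := MVT_segment ab dr; first exact: antiderivative_within.
rewrite in_itv/= => /andP[ac cb] ->; rewrite ![_ * (b - a)]mulrC.
by apply/andP; split; apply: ler_wpM2l; rewrite ?subr_ge0//;
  apply: (dickman_anti hrho); lra.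
Qed.

(** The difference of the two sides has derivative
    [rho(x) + x rho'(x) - rho(x) + rho(x - 1) = 0] on []1, t[], and both sides
    equal 1 at 1. *)
Lemma dickman_integral t : 1 <= t -> t * rho t = P t - P (t - 1).
Proof.
move=> t1.
pose H x := x * rho x - P x + P (x - 1).
have P1 : P 1 - P 0 = 1.
  have := antiderivative_bounds (lexx 0) ler01.
  by rewrite !(dickman_eq1 hrho) ?lexx ?ler01// !subr0 !mulr1 => /le_anti.
have dH x : x \in `]1, t[%R -> is_derive x 1 H 0.
  rewrite in_itv/= => /andP[x1 _].
  have ? := dickman_derive hrho x1.
  have ? : is_derive x 1 P (rho x) by apply: dP; lra.
  have dP1 : is_derive (x - 1) 1 P (rho (x - 1)) by apply: dP; lra.
  have ? := @is_derive1_comp R P (shift (- 1)) x _ _ dP1 (is_derive_shift x 1 (- 1)).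
  have -> : H = (id : R -> R) * rho - P + (P \o shift (- 1)) by [].
  apply: is_derive_eq; rewrite /GRing.scale/=; field; lra.
have cH : {within `[1, t], continuous H}.
  have cP x : 0 <= x -> {for x, continuous P}.
    by move=> x0; apply: differentiable_continuous; apply/derivable1_diffP;
       have [] := dP x0.
  apply: continuous_subspace_itv => x; rewrite in_itv/= => /andP[x1 _].
  apply: cvgD; last first.
    apply: (@cvg_comp _ _ _ (shift (-1)) P); last by apply: cP; lra.
    by apply: cvgD; [exact: cvg_id|exact: cvg_cst].
  apply: cvgB; last by apply: cP; lra.
  by apply: cvgM; [exact: cvg_id|apply: (dickman_continuous hrho); lra].
have [c _] := MVT_segment t1 dH cH.
rewrite mul0r /H subrr mul1r (dickman_eq1 hrho (_ : 0 <= 1 <= 1)) ?ler01 ?lexx// => h.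
lra.
Qed.

(** Cut [int_(u-1)^u rho], with [u = N / M], into [M] intervals of length
    [1 / M] and bound [rho] on each by its values at the end points. *)
Lemma dickman_riemann_bounds M N : (0 < M)%N -> (M <= N)%N ->
  \sum_(k < M) rho ((N - k)%:R / M%:R) <= N%:R * rho (N%:R / M%:R)
    <= \sum_(k < M) rho ((N - k.+1)%:R / M%:R).
Proof.
move=> M0 MN; have M0R : 0 < M%:R :> R by rewrite ltr0n.
pose d k := P ((N - k)%:R / M%:R) - P ((N - k.+1)%:R / M%:R).
have -> : N%:R * rho (N%:R / M%:R) = \sum_(k < M) M%:R * d k.
  rewrite -mulr_sumr (_ : \sum_(k < M) d k = P (N%:R / M%:R) - P (N%:R / M%:R - 1)).
    rewrite -dickman_integral; last by rewrite ler_pdivlMr// mul1r ler_nat.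
    by field; rewrite gt_eqF.
  rewrite -(big_mkord xpredT d) /d.
  rewrite (eq_bigr (fun k => - P ((N - k.+1)%:R / M%:R) - - P ((N - k)%:R / M%:R))).
    rewrite telescope_sumr// subn0 natrB// mulrBl mulfV ?gt_eqF//.
    by rewrite opprK addrC.
  by move=> k _; rewrite opprK addrC.
have bd (k : 'I_M) : rho ((N - k)%:R / M%:R) <= M%:R * d k
    <= rho ((N - k.+1)%:R / M%:R).
  have kN : (k < N)%N by rewrite (leq_trans _ MN).
  have a0 : 0 <= (N - k.+1)%:R / M%:R :> R by rewrite divr_ge0.
  have ab : (N - k.+1)%:R / M%:R <= (N - k)%:R / M%:R :> R.
    by rewrite ler_pM2r ?invr_gt0// ler_nat leq_sub2l.
  have := antiderivative_bounds a0 ab.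
  rewrite -mulrBl -natrB ?leq_sub2l// -(subnSK kN) subSnn mul1r subnSK//.
  by rewrite !ler_pdivrMl// !ler_pdivlMl// mulrC => /andP[-> ->].
by apply/andP; split; apply: ler_sum => k _; have /andP[] := bd k.
Qed.

End DickmanIntegral.

(** * Comparison of the smoothness probabilities with the Dickman function *)

Section Sandwich.
Variables (R : realType) (rho : R -> R).
Hypothesis hrho : is_dickman rho.

Lemma smooth_prob_ge_dickman m n : (0 < m)%N ->
  rho (n%:R / m%:R) <= smooth_prob R m n.
Proof.
move=> m0; elim/ltn_ind: n => n IHn; have [nm|mn] := leqP n m.
  by rewrite smooth_prob_eq1// (dickman_le1 hrho)// divr_ge0.
have n0 : (0 < n)%N by exact: leq_ltn_trans mn.
have n0R : 0 < n%:R :> R by rewrite ltr0n.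
have [P dP] := dickman_antiderivative hrho.
rewrite -(ler_pM2l n0R) smooth_prob_rec// 1?ltnW//.
have /andP[_] := dickman_riemann_bounds hrho dP m0 (ltnW mn).
move=> /le_trans; apply; apply: ler_sum => k _.
by apply: IHn; rewrite ltn_subrL.
Qed.

(** With [N = n + 1] and [M = m + 1], the lower Riemann sum has one extra term,
    [rho(N / M)] itself, which brings the factor [n + 1] on the other side down
    to the [n] of the recurrence. *)
Lemma smooth_prob_le_dickman m n : (0 < m)%N ->
  smooth_prob R m n <= rho (n.+1%:R / m.+1%:R).
Proof.
move=> m0; elim/ltn_ind: n => n IHn; have [nm|mn] := leqP n m.
  rewrite smooth_prob_eq1// (dickman_eq1 hrho)// divr_ge0//=.
  by rewrite ler_pdivrMr// mul1r ler_nat.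
have n0 : (0 < n)%N by exact: leq_ltn_trans mn.
have n0R : 0 < n%:R :> R by rewrite ltr0n.
have [P dP] := dickman_antiderivative hrho.
rewrite -(ler_pM2l n0R) smooth_prob_rec// 1?ltnW//.
have /andP[] := dickman_riemann_bounds hrho dP (ltn0Sn m) (ltnW mn : m < n.+1)%N.
rewrite big_ord_recl subn0; set v := rho (n.+1%:R / _).
rewrite -[n.+1%:R]natr1 mulrDl mul1r addrC lerD2r.
move=> h _; apply: le_trans h; apply: ler_sum => k _.
have kn : (k < n)%N by rewrite (leq_trans _ (ltnW mn)).
apply: le_trans (IHn _ _) _; first by rewrite ltn_subrL.
by rewrite subnSK// lift0 subSS.
Qed.

(** Each of the [m] terms of the recurrence has an argument of quotient at least
    [n %/ m - 1], and [m / n] is at most [1 / (n %/ m)]. *)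
Lemma smooth_prob_le_fact m n : (0 < m)%N ->
  smooth_prob R m n <= ((n %/ m)`!%:R)^-1.
Proof.
move=> m0; elim/ltn_ind: n => n IHn; have [nm|mn] := ltnP n m.
  by rewrite smooth_prob_eq1 ?divn_small// 1?ltnW// invr1.
have n0 : (0 < n)%N by exact: leq_trans mn.
have n0R : 0 < n%:R :> R by rewrite ltr0n.
have q0 : (0 < n %/ m)%N by rewrite divn_gt0.
rewrite -(ler_pM2l n0R) smooth_prob_rec//.
apply: (@le_trans _ _ (\sum_(k < m) ((n %/ m).-1`!%:R)^-1)).
  apply: ler_sum => k _; have kn : (k < n)%N by rewrite (leq_trans _ mn).
  apply: le_trans (IHn _ _) _; first by rewrite ltn_subrL.
  rewrite lef_pV2 ?posrE ?ltr0n ?fact_gt0// ler_nat.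
  apply: leq_fact; rewrite -subn1 leq_subLR.
  have -> : (n %/ m = 1 + (n - m) %/ m)%N by rewrite -divnMDl// mul1n subnKC.
  by rewrite leq_add2l leq_div2r// leq_sub2l.
rewrite sumr_const card_ord -[_ *+ m]mulr_natl -[in leRHS](prednK q0) factS natrM.
rewrite invfM mulrA ler_pM2r ?invr_gt0 ?ltr0n ?fact_gt0// prednK//.
by rewrite ler_pdivlMr ?ltr0n// -natrM ler_nat mulnC leq_trunc_div.
Qed.

End Sandwich.
(** * Asymptotics *)

Lemma ln_succ_sub_le (R : realType) (q : nat) : (0 < q)%N ->
  ln q.+1%:R - ln q%:R <= q%:R^-1 :> R.
Proof.
move=> q0; have q0R : 0 < q%:R :> R by rewrite ltr0n.
have v0 : 0 < q%:R^-1 :> R by rewrite invr_gt0.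
rewrite -ln_div ?posrE ?ltr0n// -natr1 mulrDl mulfV ?gt_eqF// mul1r.
by apply: le_ln1Dx; lra.
Qed.

Lemma ln_fact_ge (R : realType) (q : nat) :
  q%:R * ln q%:R - q%:R <= ln (q`!%:R) :> R.
Proof.
elim: q => [|q IHq]; first by rewrite mul0r subr0 fact0 ln1.
rewrite factS natrM lnM ?posrE ?ltr0n ?fact_gt0//.
apply: le_trans (lerD (lexx _) IHq).
have [->|q0] := posnP q; first by rewrite ln1; lra.
have q0R : 0 < q%:R :> R by rewrite ltr0n.
have := ln_succ_sub_le R q0; rewrite -(ler_pM2l q0R) mulfV ?gt_eqF// => h.
rewrite -[q.+1%:R in X in X * _ - _]natr1 -[q.+1%:R in X in _ - X]natr1.
by move: h; rewrite mulrDl mulrBr; lra.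
Qed.

Section Asymptotics.
Variables (R : realType) (rho : R -> R).
Hypothesis hrho : is_dickman rho.
Implicit Types t u U d eta : R.

(** Keeping only [[t - 1, t - 1 + d]] in the integral equation gives
    [t rho(t) >= d rho(t - 1 + d)]: a step of length [1 - d] to the left costs a
    factor [d / u], and [k] such steps reach [[0, 1]], where [rho = 1]. *)
Lemma dickman_ge_exp d u k t : 0 < d < 1 -> 1 <= u ->
  0 <= t <= u -> t <= 1 + k%:R * (1 - d) -> (d / u) ^+ k <= rho t.
Proof.
move=> /andP[d0 d1] u1; elim: k t => [|k IHk] t /andP[t0 tu] tk.
  by rewrite expr0 (dickman_eq1 hrho)// t0; lra.
have du : 0 <= d / u <= 1.
  by rewrite divr_ge0/= ?ler_pdivrMr; lra.
have [t1|t1] := leP t 1.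
  by rewrite (dickman_eq1 hrho) ?t0// exprn_ile1//; have /andP[] := du.
have [P dP] := dickman_antiderivative hrho.
have tE := dickman_integral hrho dP (ltW t1).
have s0 : 0 <= t - 1 by lra.
have ss : t - 1 <= t - 1 + d by lra.
have s1 : 0 <= t - 1 + d by lra.
have st : t - 1 + d <= t by lra.
have /andP[h1 _] := antiderivative_bounds hrho dP s0 ss.
have /andP[h2 _] := antiderivative_bounds hrho dP s1 st.
have h3 : 0 <= (t - (t - 1 + d)) * rho t.
  by rewrite mulr_ge0 ?ltW ?(dickman_gt0 hrho)//; lra.
have h4 : d * rho (t - 1 + d) <= t * rho t.
  rewrite tE; move: h1; have -> : t - 1 + d - (t - 1) = d by ring.
  lra.
have h5 : (d / u) ^+ k <= rho (t - 1 + d).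
  apply: IHk; first by apply/andP; split; lra.
  by move: tk; rewrite -natr1 mulrDl; lra.
rewrite exprS mulrAC ler_pdivrMr; last lra.
apply: (@le_trans _ _ (t * rho t)); last first.
  by rewrite mulrC ler_wpM2l// ltW// (dickman_gt0 hrho).
by apply: le_trans h4; rewrite ler_wpM2l// ltW.
Qed.

Lemma neg_ln_dickman_le d u : 0 < d < 1 -> 1 <= u ->
  - ln (rho u) <= (u / (1 - d) + 1) * (ln u - ln d).
Proof.
move=> dd u1; have /andP[d0 d1] := dd.
have e0 : 0 < 1 - d by lra.
have w0 : 0 <= u / (1 - d) by rewrite divr_ge0; lra.
pose k := (Num.truncn (u / (1 - d))).+1.
have /andP[k1 k2] := truncn_itv w0.
have uk : u <= 1 + k%:R * (1 - d).
  by move: k2; rewrite ltr_pdivrMr// /k; lra.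
have du0 : 0 < d / u by rewrite divr_gt0//; lra.
have u0 : 0 <= u <= u by rewrite lexx andbT; lra.
have rk := dickman_ge_exp dd u1 u0 uk.
have : ln ((d / u) ^+ k) <= ln (rho u).
  by rewrite ler_ln ?posrE ?exprn_gt0// (dickman_gt0 hrho)//; lra.
rewrite lnXn// ln_div ?posrE//; last lra.
move=> h; apply: (@le_trans _ _ (k%:R * (ln u - ln d))).
  by rewrite mulr_natl -[ln u - _]opprB mulNrn lerN2.
apply: ler_wpM2r; last by rewrite /k -natr1; lra.
have : 0 <= ln u by exact: ln_ge0.
have : ln d <= 0 by apply: ln_le0; lra.
lra.
Qed.

(** Taking [d = eta / 2] in [neg_ln_dickman_le], the leading coefficient
    [(1 - eta) / (1 - d)] is at most [1 - d]; half of this gain absorbs the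
    shifts of [q] and the other half, multiplied by [ln q], the bounded
    terms. *)
Lemma ln_fact_ge_neg_ln_dickman eta : 0 < eta < 1 ->
  exists Q, forall q, (Q <= q)%N ->
    (1 - eta) * - ln (rho q.+1%:R) <= ln q`!%:R.
Proof.
move=> /andP[e0 e1]; pose d := eta / 2; pose D := - ln d.
have d0 : 0 < d by rewrite /d; lra.
have d1 : d < 1 by rewrite /d; lra.
have D0 : 0 <= D by rewrite /D oppr_ge0 ln_le0//; lra.
pose B := Num.max (4 / d) (expR (2 / d * (2 + D))).
have B0 : 0 < B by rewrite lt_max expR_gt0 orbT.
exists (Num.truncn B).+1 => q Qq.
have Bq : B <= q%:R.
  by apply: ltW; apply: lt_le_trans (truncnS_gt B) _; rewrite ler_nat.
have q0 : 0 < q%:R :> R by exact: lt_le_trans Bq.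
pose X : R := ln q%:R.
have /andP[q4 qX] : (4 / d <= q%:R) && (2 / d * (2 + D) <= X).
  move: Bq; rewrite ge_max => /andP[-> h]/=.
  by rewrite -[leLHS]expRK ler_ln ?posrE ?expR_gt0.
apply: le_trans (ln_fact_ge R q); rewrite -/X.
have q1 : 1 <= q.+1%:R :> R by rewrite ler1n.
have dd : 0 < d < 1 by rewrite d0.
have e1' : 0 < 1 - eta by lra.
apply: (@le_trans _ _ ((1 - eta) * ((q.+1%:R / (1 - d) + 1) * (ln q.+1%:R - ln d)))).
  by rewrite ler_pM2l//; exact: neg_ln_dickman_le.
have Xs : ln q.+1%:R <= X + 1.
  have qn : (0 < q)%N by rewrite -(ltr0n R).
  have := ln_succ_sub_le R qn; have : q%:R^-1 <= 1 :> R by rewrite invf_le1 ?ler1n.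
  by rewrite /X; lra.
have X0 : 0 <= X by apply: le_trans qX; rewrite mulr_ge0 ?divr_ge0//; lra.
have c1 : (1 - eta) * (q.+1%:R / (1 - d) + 1) <= (1 - d / 2) * q%:R.
  rewrite -(@ler_pM2r _ (1 - d)); last lra.
  have -> : (1 - eta) * (q.+1%:R / (1 - d) + 1) * (1 - d)
      = (1 - 2 * d) * (q%:R + 2 - d).
    by rewrite -natr1 /d; field; rewrite gt_eqF; lra.
  have q4' : 4 <= q%:R * d by rewrite -ler_pdivrMr.
  have : 0 <= d ^+ 2 * q%:R by rewrite mulr_ge0 ?sqr_ge0.
  have : 0 <= d * (1 - d) by rewrite mulr_ge0; lra.
  by move: q4'; lra.
have L0 : 0 <= ln q.+1%:R - ln d.
  by rewrite addr_ge0// ln_ge0.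
rewrite mulrA; apply: (@le_trans _ _ ((1 - d / 2) * q%:R * (X + 1 + D))).
  apply: ler_pM => //; last by rewrite /D; lra.
  apply: mulr_ge0; first lra.
  by rewrite addr_ge0// divr_ge0//; lra.
rewrite -[X in _ <= _ - X]mulr1 -mulrBr mulrC mulrA [leRHS]mulrC.
rewrite ler_pM2r//.
have h : 2 + D <= X * (d / 2).
  move: qX; rewrite -ler_pdivlMl; last by rewrite divr_gt0.
  by rewrite invf_div mulrC.
move: h X0 D0 d0 d1; clearbody X D d; clear; nra.
Qed.

(** Let [v = (n + 1) / (m + 1)], so that [p n <= rho v] and
    [u - v = (u - 1) / (m + 1)].  The loss [ln (rho v) - ln (rho u)] is at most
    [(u - v) / rho U], and [- ln (rho u) >= 1 - rho u] is at least
    [(u - 1) rho U / U]; the factor [u - 1] cancels, so the estimate is uniform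
    down to [u = 1]. *)
Lemma neg_ln_bounded_range eta U : 0 < eta -> 1 <= U ->
  exists N, forall n m, (N <= n)%N -> (0 < m <= n)%N -> n%:R <= U * m%:R ->
    (1 - eta) * - ln (rho (n%:R / m%:R)) <= - ln (smooth_prob R m n).
Proof.
move=> e0 U1; have U0 : 0 < U by lra.
have r0 : 0 < rho U by apply: (dickman_gt0 hrho); lra.
pose B := U ^+ 2 / (rho U ^+ 2 * eta).
have B0 : 0 <= B by rewrite divr_ge0 ?sqr_ge0// mulr_ge0 ?sqr_ge0// ltW.
exists (Num.truncn B).+1 => n m Nn /andP[m0 mn] nU.
have nB : B <= n%:R.
  have /andP[_ h] := truncn_itv B0; apply: ltW; apply: lt_le_trans h _.
  by rewrite ler_nat.
have m0R : 0 < m%:R :> R by rewrite ltr0n.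
set u := n%:R / m%:R; set v : R := n.+1%:R / m.+1%:R.
have u1 : 1 <= u by rewrite ler_pdivlMr// mul1r ler_nat.
have uU : u <= U by rewrite ler_pdivrMr.
have v1 : 1 <= v by rewrite ler_pdivlMr ?ltr0n// mul1r ler_nat.
have uv : u - v = (u - 1) / m.+1%:R.
  by rewrite /u /v -[n.+1%:R]natr1 -[m.+1%:R]natr1; field; rewrite gt_eqF//; lra.
have vu : v <= u by rewrite -subr_ge0 uv divr_ge0//; lra.
have ru0 : 0 < rho u by apply: (dickman_gt0 hrho); lra.
have rv0 : 0 < rho v by apply: (dickman_gt0 hrho); lra.
have rUu : rho U <= rho u by apply: (dickman_anti hrho); lra.
have pv : ln (smooth_prob R m n) <= ln (rho v).
  rewrite ler_ln ?posrE ?(smooth_prob_le_dickman hrho)//.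
  exact: lt_le_trans ru0 (smooth_prob_ge_dickman hrho n m0).
have num : ln (rho v) - ln (rho u) <= (u - 1) / m.+1%:R / rho U.
  rewrite -ln_div ?posrE// -[rho v / _](subrKC 1) .
  apply: le_trans (le_ln1Dx _) _.
    by rewrite -subr_gt0 opprK subrK divr_gt0.
  have -> : rho v / rho u - 1 = (rho v - rho u) / rho u by field; rewrite gt_eqF.
  rewrite -uv; apply: ler_pM.
  - by rewrite subr_ge0 (dickman_anti hrho)//; lra.
  - by rewrite invr_ge0 ltW.
  - exact: (dickman_diff_le hrho).
  - by rewrite lef_pV2 ?posrE.
have den : (u - 1) * (rho U / U) <= - ln (rho u).
  apply: le_trans (dickman_compl_ge hrho u1 uU) _.
  rewrite lerNr opprB -[rho u in leLHS](subrKC 1).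
  by apply: le_ln1Dx; lra.
suff : (u - 1) / m.+1%:R / rho U <= eta * ((u - 1) * (rho U / U)).
  move=> h; have : eta * ((u - 1) * (rho U / U)) <= eta * - ln (rho u).
    by rewrite ler_pM2l.
  move=> /(le_trans h)/(le_trans num) h2; rewrite [leLHS]mulrBl mul1r.
  by move: pv h2; lra.
have -> : (u - 1) / m.+1%:R / rho U = (u - 1) * (m.+1%:R^-1 / rho U) by rewrite mulrA.
rewrite [leRHS]mulrCA; apply: ler_wpM2l; first lra.
rewrite ler_pdivrMr// -[X in X <= _]mul1r ler_pdivrMr ?ltr0n//.
have -> : eta * (rho U / U) * rho U = (rho U ^+ 2 * eta) / U by field; rewrite gt_eqF.
move: nB; rewrite /B ler_pdivrMr ?mulr_gt0 ?exprn_gt0// => nB.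
rewrite mulrAC ler_pdivlMr// mul1r -(ler_pM2l U0) -expr2.
apply: le_trans nB _; rewrite [leRHS]mulrCA mulrC ler_pM2l ?mulr_gt0 ?exprn_gt0//.
apply: le_trans nU _; rewrite ler_pM2l// ler_nat//.
Qed.

End Asymptotics.

Theorem corollary1p9 (R : realType) (rho : R -> R) (hrho : is_dickman rho) :
  forall eta : R, 0 < eta ->
  exists N : nat, forall n m : nat, (N <= n)%N -> (1 <= m <= n)%N ->
    `|ln (fin_uniform_prob R (@smooth_perm n m))
        - ln (rho (n%:R / m%:R))|
      <= eta * `|ln (rho (n%:R / m%:R))|.
Proof.
move=> eta eta0; pose e := Num.min eta 2^-1.
have e0 : 0 < e by rewrite lt_min eta0 invr_gt0 ltr0n.
have ee : e <= eta by rewrite ge_min lexx.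
have e1 : e < 1 by rewrite gt_min; apply/orP; right; lra.
have [|Q HQ] := ln_fact_ge_neg_ln_dickman hrho (_ : 0 < e < 1); first by rewrite e0.
have U1 : 1 <= Q.+1%:R :> R by rewrite ler1n.
have [N HN] := neg_ln_bounded_range hrho e0 U1.
exists N => n m Nn /andP[m0 mn]; rewrite fin_uniform_prob_smooth//.
set u := n%:R / m%:R; set p := smooth_prob R m n.
have m0R : 0 < m%:R :> R by rewrite ltr0n.
have u0 : 0 <= u by rewrite divr_ge0.
have ru0 := dickman_gt0 hrho u0.
have rup : rho u <= p := smooth_prob_ge_dickman hrho n m0.
have p0 : 0 < p := lt_le_trans ru0 rup.
have lru : ln (rho u) <= 0 by rewrite ln_le0// (dickman_le1 hrho).
have lrup : ln (rho u) <= ln p by rewrite ler_ln ?posrE.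
rewrite ger0_norm ?subr_ge0// ler0_norm//.
suff main : (1 - e) * - ln (rho u) <= - ln p.
  apply: le_trans (_ : e * - ln (rho u) <= _); first by move: main; rewrite mulrBl; lra.
  by rewrite ler_wpM2r// oppr_ge0.
have [Qq|qQ] := leqP Q (n %/ m)%N.
  have uq : u <= (n %/ m).+1%:R.
    by rewrite ler_pdivrMr// -natrM ler_nat ltnW// ltn_ceil.
  have := HQ _ Qq; have := smooth_prob_le_fact R n m0; rewrite -/p => pf hq.
  apply: (@le_trans _ _ ((1 - e) * - ln (rho (n %/ m).+1%:R))).
    rewrite ler_pM2l ?subr_gt0// lerN2 ler_ln ?posrE// ?(dickman_gt0 hrho)//.
    exact: (dickman_anti hrho).
  apply: le_trans hq _; rewrite lerNr -lnV ?posrE ?ltr0n ?fact_gt0//.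
  by rewrite ler_ln// posrE invr_gt0 ltr0n fact_gt0.
apply: HN => //; first by rewrite m0.
rewrite -natrM ler_nat ltnW// (leq_trans (ltn_ceil n m0))// leq_mul2r.
by rewrite ltnW ?orbT.
Qed.
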